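(* Let $G$ be a finitely generated torsion free group that contains a copy of $\mathbb Z^2$. If $\rho:G\to\mathcal G$ is a free faithful action of $G$ by IETs, then the image $\rho(G)$ is $PL\circ IET$-conjugated to a subgroup of some $G_n$: there exist $n\ge1$, an IET $E$ and a PL-homeomorphism $R$ of $[0,1)$ such that, with $g=R\circ E$, one has $g\,\rho(G)\,g^{-1}\subset G_n$.
   Context: An interval exchange transformation (IET) is a bijection of $[0,1)$ defined by a finite partition of $[0,1)$ into half-open subintervals and a reordering of these intervals by translations; $\mathcal G$ is the group of all IETs. A PL-homeomorphism of $[0,1)$ is a homeomorphism of $[0,1)$ onto itself that is piecewise affine with finitely many pieces. A group acts freely on $[0,1)$ if the only element having some fixed point is the trivial element; an action $\rho:G\to\mathcal G$ is faithful if $\rho$ is injective. Let $\mathcal S_n$ be the group of permutations of $\{1,\dots,n\}$, $\mathbb S_n=[0,\frac1n]/(0=\frac1n)\cong\mathbb R/\frac1n\mathbb Z$, and $I_i=[\frac{i-1}{n},\frac in)$. $G_n$ is the group of IETs $g$ for which there are $\sigma_g\in\mathcal S_n$ and $\alpha_g=(\alpha_1(g),\dots,\alpha_n(g))\in\mathbb S_n^n$ such that $g$ maps $I_i$ onto $I_{\sigma_g(i)}$ by translating $I_i$ to $I_{\sigma_g(i)}$ and then rotating by $\alpha_i(g)$ (mod $\frac1n$ inside $I_{\sigma_g(i)}$). *)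

(* Defs.v *)
From HB Require Import structures.
From mathcomp Require Import all_boot all_order all_algebra perm.
From mathcomp Require Import all_classical all_reals.
From mathcomp Require Import topology normedtype numfun.

Set Implicit Arguments.
Unset Strict Implicit.
Unset Printing Implicit Defensive.

Import Order.TTheory GRing.Theory Num.Theory.
Import numFieldNormedType.Exports.

Local Open Scope classical_set_scope.
Local Open Scope ring_scope.

(* The group of all bijections of an arbitrary (possibly infinite) type; the
   product [f * g] is the composition [f \o g]. *)
Record bijection (T : Type) := Bijection {
  bij_fun :> T -> T;
  bij_inv : T -> T;
  bij_funK : cancel bij_fun bij_inv;
  bij_invK : cancel bij_inv bij_fun }.

Section BijectionGroup.
Variable T : Type.
Implicit Types f g : bijection T.

Lemma bijection_ext f g : bij_fun f =1 bij_fun g -> f = g.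
Proof.
case: f g => [f f' fK f'K] [g g' gK g'K] /= fg.
have {}fg : f = g by apply/funext.
rewrite -fg in gK g'K *.
have f'g' : f' = g' by apply/funext => y; rewrite -{1}(g'K y) fK.
rewrite -f'g' in gK g'K *.
by congr Bijection; exact: Prop_irrelevance.
Qed.

Definition bijection_one : bijection T :=
  @Bijection T id id (fun=> erefl) (fun=> erefl).

Definition bijection_inv f : bijection T :=
  Bijection (@bij_invK T f) (@bij_funK T f).

Definition bijection_mul f g : bijection T :=
  Bijection (can_comp (@bij_funK T f) (@bij_funK T g))
            (can_comp (@bij_invK T g) (@bij_invK T f)).

HB.instance Definition _ := gen_eqMixin (bijection T).
HB.instance Definition _ := gen_choiceMixin (bijection T).

Lemma bijection_mulA : associative bijection_mul.
Proof. by move=> f g h; apply: bijection_ext. Qed.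

Lemma bijection_mul1 : left_id bijection_one bijection_mul.
Proof. by move=> f; apply: bijection_ext. Qed.

Lemma bijection_mulr1 : right_id bijection_one bijection_mul.
Proof. by move=> f; apply: bijection_ext. Qed.

Lemma bijection_mulV : left_inverse bijection_one bijection_inv bijection_mul.
Proof. by move=> f; apply: bijection_ext => x /=; rewrite bij_funK. Qed.

Lemma bijection_mulrV : right_inverse bijection_one bijection_inv bijection_mul.
Proof. by move=> f; apply: bijection_ext => x /=; rewrite bij_invK. Qed.

HB.instance Definition _ := isGroup.Build (bijection T)
  bijection_mulA bijection_mul1 bijection_mulr1 bijection_mulV bijection_mulrV.

End BijectionGroup.

Section GroupProperties.
Variable G : groupType.

Definition finitely_generated : Prop :=
  exists s : seq G, forall H : {pred G},
    group_closed H -> {subset s <= H} -> forall x, x \in H.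

Definition torsion_free : Prop :=
  forall (x : G) (n : nat), (0 < n)%N -> (x ^+ n = 1)%g -> x = 1%g.

Definition contains_Z2 : Prop :=
  exists f : int * int -> G,
    injective f /\ (forall u v, f (u + v) = (f u * f v)%g).

End GroupProperties.

Section IntervalExchange.
Variable R : realType.

(* Elements of [I01] carry the subspace topology of [R]. *)
Definition I01 : Type := set_type (`[0, 1[%classic : set R).
HB.instance Definition _ := Topological.on I01.

(* For [s = [:: a_1; ...; a_k]] with [0 < a_1 < ... < a_k = 1], the property
   [P] holds for the restriction of [f] to each half-open piece
   [`[a_(i-1), a_i[], where [a_0 = 0]. *)
Definition piecewise (P : (I01 -> R) -> set I01 -> Prop) (f : I01 -> I01) :=
  exists2 s : seq R, itv_partition 0 1 s &
    forall i, (i < size s)%N ->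
      P (fun x => \val (f x))
        [set x | nth 0 (0 :: s) i <= \val x < nth 0 s i].

Definition translation_on (f : I01 -> R) (D : set I01) : Prop :=
  exists t : R, forall x, D x -> f x = \val x + t.

Definition affine_on (f : I01 -> R) (D : set I01) : Prop :=
  exists a b : R, forall x, D x -> f x = a * \val x + b.

(* The reordering of the pieces is determined by bijectivity. *)
Definition IET : set (bijection I01) :=
  [set f | piecewise translation_on f].

Definition PL_homeo : set (bijection I01) :=
  [set f | [/\ continuous (bij_fun f),
               continuous (bij_inv f) &
               piecewise affine_on f]].

(* Representative in [`[0, 1/n[] of the class of [t] in R/(1/n)Z, for n > 0. *)
Definition mod_inv (n : nat) (t : R) : R :=
  t - (Num.floor (n%:R * t))%:~R / n%:R.

(* Indices start at 0, so the i-th interval is [`[i/n, (i+1)/n[]; the angles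
   [alpha i] in R/(1/n)Z are given by arbitrary real representatives. *)
Definition Gn (n : nat) : set (bijection I01) :=
  [set g | IET g /\
    exists (sigma : 'S_n) (alpha : 'I_n -> R),
      forall (i : 'I_n) (x : I01),
        i%:R / n%:R <= \val x < i.+1%:R / n%:R ->
        \val (g x) =
          (sigma i)%:R / n%:R + mod_inv n (\val x - i%:R / n%:R + alpha i)].

Definition free_action (G : groupType) (rho : G -> bijection I01) : Prop :=
  forall x : G, (exists t : I01, rho x t = t) -> x = 1%g.

End IntervalExchange.

(* Main.v *)
Require Import Defs.
From mathcomp Require Import all_boot all_order all_algebra.
From mathcomp Require Import all_classical all_reals.
From mathcomp Require Import perm topology normedtype numfun ring lra zify.

(* View [0,1) as the circle R/Z.  An IET [g] has a left-continuous version
   [g_-], which differs from [g] at finitely many points, and [g |-> g_-] is a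
   homomorphism.  If [a] and [b] generate a free action of Z^2, the sequence
   [a_-^(-n) (a^n x)] is eventually constant; its limit [theta x] satisfies
   [theta a = a_- theta], and [theta] moves finitely many points because a
   moved point far away on an [a]-orbit would have infinitely many moved points
   on its [b]-orbit.  Cut the circle at the finitely many points [p] that matter
   and glue the right side of [p] to the left side of [theta p]: the result is
   a finite union of circles, carrying a unit speed flow, and an IET [g] with
   [theta g = g_- theta] commutes with this flow.

   Let [H] be the group of the [g] in [G] such that [theta g = g_- theta].
   - If [h <> 1] and [c h c^-1] are in [H], so is [c]: the points where
     [theta c] and [c_- theta] disagree form a finite set invariant under the
     infinite order element [h], which acts freely.
   - By recurrence, near any given point some nontrivial element of [H] is an
     arbitrarily small translation.  Given [g] in [G], take such [h] at [y] and
     [k] at [g^-1 y]; then [h] and [h' = g k g^-1] commute at [y], hence commute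
     by freeness.  Applying the first point twice, [h'] and then [g] are in [H].

   So all of [G] commutes with the flow.  The IET [E] lays the circles out
   consecutively and the PL map [P] rescales each of them to length [1/n]. *)

Set Implicit Arguments.
Unset Strict Implicit.
Unset Printing Implicit Defensive.

Import Order.TTheory GRing.Theory Num.Theory.
Import numFieldNormedType.Exports.

Local Open Scope classical_set_scope.
Local Open Scope ring_scope.

(** * Interval exchanges as maps of the circle *)

Section Circle.
Variable R : realType.
Implicit Types (r s t u : R) (x y : I01 R).

(* A synonym of [\val] that is stable under simplification. *)
Definition pos x : R := \val x.
Arguments pos : simpl never.

Lemma pos_inj : injective pos.
Proof. exact: val_inj. Qed.

Lemma frac_itv r : `[0, 1[%classic (r - (Num.floor r)%:~R).
Proof.
have /andP[h1 h2] := floor_itv r.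
rewrite /= in_itv /= subr_ge0 h1 /= ltrBlDr.
by rewrite intrD addrC in h2.
Qed.

(* [I01 R] is viewed as the circle [R / Z]; [circ] is the projection. *)
Definition circ r : I01 R :=
  exist (fun u => u \in `[0, 1[%classic) _ (mem_set (frac_itv r)).
Arguments circ : simpl never.

Lemma circE r : pos (circ r) = r - (Num.floor r)%:~R.
Proof. by []. Qed.

Lemma I01P x : 0 <= pos x < 1.
Proof. by case: x => r rP; have := set_mem rP; rewrite /= in_itv. Qed.

Lemma I01_ge0 x : 0 <= pos x.
Proof. by case/andP: (I01P x). Qed.

Lemma I01_lt1 x : pos x < 1.
Proof. by case/andP: (I01P x). Qed.

Lemma circ_id r : 0 <= r < 1 -> pos (circ r) = r.
Proof.
by move=> h; rewrite circE (@floor_def _ r 0) ?subr0 // addr0.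
Qed.

Lemma circK x : circ (pos x) = x.
Proof. by apply: pos_inj; rewrite circ_id ?I01P. Qed.

Lemma circDz r (z : int) : circ (r + z%:~R) = circ r.
Proof.
apply: pos_inj; rewrite !circE floorDrz // intrKfloor intrD; lra.
Qed.

Definition rotate t x : I01 R := circ (pos x + t).
Arguments rotate : simpl never.

Lemma rotate_circ t r : rotate t (circ r) = circ (r + t).
Proof.
rewrite /rotate circE -[RHS](circDz _ (- Num.floor r)) intrN; congr circ; lra.
Qed.

Lemma rotateD s t x : rotate s (rotate t x) = rotate (t + s) x.
Proof. by rewrite -[x]circK !rotate_circ addrA. Qed.

Lemma rotate0 x : rotate 0 x = x.
Proof. by rewrite /rotate addr0 circK. Qed.

Lemma rotateK t : cancel (rotate t) (rotate (- t)).
Proof. by move=> x; rewrite rotateD subrr rotate0. Qed.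

Lemma rotate_inj t : injective (rotate t).
Proof. exact: can_inj (rotateK t). Qed.

Lemma pos_rotate t x : 0 <= pos x + t < 1 -> pos (rotate t x) = pos x + t.
Proof. exact: circ_id. Qed.

Definition left_germ (f : I01 R -> I01 R) x y :=
  exists2 e : R, 0 < e &
    forall t, 0 < t < e -> f (rotate (- t) x) = rotate (- t) y.

Definition right_germ (f : I01 R -> I01 R) x :=
  exists2 e : R, 0 < e &
    forall t, 0 <= t < e -> f (rotate t x) = rotate t (f x).

Lemma left_germ_uniq f x y z : left_germ f x y -> left_germ f x z -> y = z.
Proof.
move=> [e e0 he] [d d0 hd]; pose t := Num.min e d / 2.
have m0 : 0 < Num.min e d by rewrite lt_min e0 d0.
have t0 : 0 < t by rewrite divr_gt0.
have tm : t < Num.min e d by rewrite /t; lra.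
move: tm; rewrite lt_min => /andP[te td].
apply: (@rotate_inj (- t)); rewrite -he ?t0 //.
by rewrite -hd ?t0.
Qed.

Lemma left_germ_comp f g x y z :
  left_germ g x y -> left_germ f y z -> left_germ (f \o g) x z.
Proof.
move=> [e e0 he] [d d0 hd]; exists (Num.min e d); first by rewrite lt_min e0 d0.
move=> t /andP[t0]; rewrite lt_min => /andP[te td] /=.
by rewrite he ?t0 // hd ?t0.
Qed.

Lemma left_germ_id x : left_germ id x x.
Proof. by exists 1. Qed.

Lemma path_locate_right (s : seq R) a (w : R) :
  path <%R a s -> a < w <= last a s ->
  exists2 i, (i < size s)%N & nth 0 (a :: s) i < w <= nth 0 s i.
Proof.
elim: s a => [|b s IH] a /=; first by move=> _ /andP[h1 h2]; lra.
move=> /andP[ab ps] /andP[aw wl].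
have [wb|bw] := leP w b; first by exists 0%N => //=; rewrite aw.
have [//||i hi h] := IH b; first by rewrite bw.
by exists i.+1.
Qed.

Lemma path_locate_left (s : seq R) a (w : R) :
  path <%R a s -> a <= w < last a s ->
  exists2 i, (i < size s)%N & nth 0 (a :: s) i <= w < nth 0 s i.
Proof.
elim: s a => [|b s IH] a /=; first by move=> _ /andP[h1 h2]; lra.
move=> /andP[ab ps] /andP[aw wl].
have [bw|wb] := leP b w; last by exists 0%N => //=; rewrite aw.
have [//||i hi h] := IH b; first by rewrite bw.
by exists i.+1.
Qed.

Lemma path_nth_ge (s : seq R) a i : path <%R a s -> (i < (size s).+1)%N ->
  a <= nth 0 (a :: s) i <= last a s.
Proof.
elim: s a i => [|b s IH] a [|i] //=; rewrite ?lexx //.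
  move=> /andP[ab ps] _; have /andP[_ /=] := IH b 0%N ps isT.
  by move=> h; rewrite (le_trans (ltW ab)).
move=> /andP[ab ps] hi; have /andP[h1 h2] := IH b i ps hi.
by rewrite (le_trans (ltW ab)).
Qed.

Lemma IET_right_germ (f : bijection (I01 R)) x : IET f -> right_germ f x.
Proof.
move=> [s [ps /eqP ls] tr].
have [||i hi /andP[h1 h2]] := @path_locate_left s 0 (pos x) => //.
  by rewrite ls I01P.
have [t ht'] := tr i hi.
have ht y : nth 0 (0 :: s) i <= pos y < nth 0 s i -> pos (f y) = pos y + t.
  exact: ht'.
have s1 : nth 0 s i <= 1.
  by have /andP[_] := @path_nth_ge s 0 i.+1 ps hi; rewrite ls.
exists (nth 0 s i - pos x); first by rewrite subr_gt0.
move=> d /andP[d0 dx].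
have vx : pos (rotate d x) = pos x + d.
  by rewrite pos_rotate //; have := I01_ge0 x; lra.
have fx : pos (f x) = pos x + t by apply: ht => /=; rewrite h1.
have fdx : pos (f (rotate d x)) = pos x + d + t.
  by rewrite ht vx //; lra.
have := I01_lt1 (f (rotate d x)); have := I01_ge0 (f x).
rewrite fx fdx => g0 g1.
by apply: pos_inj; rewrite pos_rotate fx ?fdx; lra.
Qed.

Lemma IET_left_germ (f : bijection (I01 R)) : IET f ->
  exists2 D : set (I01 R), finite_set D &
    forall x, exists2 y, left_germ f x y & ~ D x -> y = f x.
Proof.
move=> [s [ps /eqP ls] tr].
exists [set` [seq circ r | r <- s]]; first exact: finite_seq.
(* The circle point 0 is approached from the left through points near 1, so it is represented here
   by 1. *)
move=> x; pose w := if pos x == 0 then 1 else pos x.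
have w01 : 0 < w <= 1.
  rewrite /w; case: eqP => [_|/eqP x0]; first by rewrite ltr01 lexx.
  by have := I01_lt1 x; have := I01_ge0 x; lra.
have cw : circ w = x.
  rewrite /w; case: eqP => [x0|_]; last exact: circK.
  by rewrite -[x]circK x0 -[1 in LHS]add0r -[1]/(1%:~R) circDz.
have [||i hi /andP[h1 h2]] := @path_locate_right s 0 w => //.
  by rewrite ls.
have [t ht'] := tr i hi.
have ht y : nth 0 (0 :: s) i <= pos y < nth 0 s i -> pos (f y) = pos y + t.
  exact: ht'.
have s0 : 0 <= nth 0 (0 :: s) i.
  by have /andP[] := @path_nth_ge s 0 i ps (leqW hi).
(* The translation of the piece on the left of [w], extended to its right end; the value may be 1,
   whence [circ]. *)
exists (circ (w + t)).
  exists (w - nth 0 (0 :: s) i); first by rewrite subr_gt0.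
  move=> d /andP[d0 dw].
  have vx : pos (rotate (- d) x) = w - d by rewrite -cw rotate_circ circ_id //; lra.
  have fdx : pos (f (rotate (- d) x)) = w - d + t by rewrite ht vx //; lra.
  have := I01P (f (rotate (- d) x)); rewrite fdx => h.
  by apply: pos_inj; rewrite rotate_circ fdx circ_id; lra.
move=> nD; have ws : w < nth 0 s i.
  rewrite lt_neqAle h2 andbT; apply/eqP => wE; apply: nD => /=.
  by rewrite -cw wE; apply: map_f; rewrite mem_nth.
have wx : w = pos x.
  rewrite -cw circ_id //; have /andP[_] := @path_nth_ge s 0 i.+1 ps hi.
  by rewrite ls /=; lra.
by rewrite -[RHS]circK ht /= -wx //; lra.
Qed.

(** Break points may be listed in any order, with repetitions and outside the interval; they are
    sorted here once and for all. *)
Lemma piecewise_of_breaks (P : (I01 R -> R) -> set (I01 R) -> Prop)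
    (f : I01 R -> I01 R) (s : seq R) :
  (forall u v, 0 <= u -> u < v -> v <= 1 ->
     (forall r, r \in s -> ~~ (u < r < v)) ->
     P (fun x => \val (f x)) [set x | u <= \val x < v]) ->
  piecewise P f.
Proof.
move=> H; pose s' : seq R := sort <=%R (undup [seq r <- s | 0 < r < 1]) ++ [:: 1].
have s'lt : sorted <%R (0 :: s').
  rewrite /s' -cat_cons cats1 -/(rcons _ _) /= rcons_path; apply/andP; split.
    rewrite path_min_sorted ?sort_lt_sorted ?undup_uniq //.
    by apply/allP => r; rewrite mem_sort mem_undup mem_filter => /andP[/andP[]].
  set S := sort _ _; have : last 0 S \in 0 :: S by exact: mem_last.
  rewrite inE => /orP[/eqP->|]; first exact: ltr01.
  by rewrite mem_sort mem_undup mem_filter => /andP[/andP[]].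
exists s'; first by split => //; rewrite /s' last_cat.
move=> i hi.
have inI := lt_sorted_ltn_nth 0 s'lt.
have last1 : last 0 s' = 1 by rewrite /s' last_cat.
have /andP[u0 _] := @path_nth_ge s' 0 i s'lt (leqW hi).
have /andP[_ v1] := @path_nth_ge s' 0 i.+1 s'lt hi.
have uv : nth 0 (0 :: s') i < nth 0 (0 :: s') i.+1 by rewrite inI ?inE //= ltnW.
apply: H => //; first by rewrite -last1.
move=> r rs; apply/negP => /andP[ur rv].
have rs' : r \in 0 :: s'.
  rewrite inE mem_cat mem_sort mem_undup mem_filter rs.
  rewrite (le_lt_trans u0 ur) (lt_le_trans rv) ?orbT //.
  by rewrite -last1.
move: ur rv; rewrite -(nth_index 0 rs') -[nth 0 s' i]/(nth 0 (0 :: s') i.+1).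
have ri : (index r (0 :: s')%R < size (0 :: s')%R)%N by rewrite index_mem.
rewrite !inI ?inE //; last by rewrite /= ltnW.
by move=> h1 h2; have := leq_trans h1 h2; rewrite ltnn.
Qed.

End Circle.

(** * Two actions that differ at finitely many points *)

Lemma finite_set_nat_bound (S : set nat) : finite_set S ->
  exists N, forall n, S n -> (n < N)%N.
Proof.
move=> /finite_seqP[s ->]; exists (\max_(i <- s) i).+1 => n /= ns.
by rewrite ltnS; apply: leq_bigmax_seq.
Qed.

Lemma expg_inj_of_torsion_free (G : groupType) (h : G) :
  torsion_free G -> h <> 1%g -> injective (fun n => (h ^+ n)%g).
Proof.
move=> tf h1 m n; wlog mn : m n / (m <= n)%N.
  move=> W e; case/orP: (leq_total m n) => mn; first exact: W.
  by symmetry; apply: W.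
move=> e; have [//|mn'] := eqVneq m n.
case: h1; apply: (tf h (n - m)%N); first by rewrite subn_gt0 ltn_neqAle mn'.
by rewrite expgnFr // -e mulgV.
Qed.

Section AlmostEqualActions.
Variables (G : groupType) (X : Type) (r l : G -> X -> X).
Hypothesis r1 : forall x, r 1%g x = x.
Hypothesis l1 : forall x, l 1%g x = x.
Hypothesis rM : forall g h x, r (g * h)%g x = r g (r h x).
Hypothesis lM : forall g h x, l (g * h)%g x = l g (l h x).
Hypothesis r_free : forall g x, r g x = x -> g = 1%g.
Hypothesis rl_fin : forall g, finite_set [set x | r g x <> l g x].

(** In the application [r] is the given action, [l] its left-continuous version, and [theta] tells
    how the sides of cut points are glued. *)
Definition intertwines (theta : X -> X) (g : G) :=
  forall x, theta (r g x) = l g (theta x).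

Lemma rVK g : cancel (r g) (r g^-1%g).
Proof. by move=> x; rewrite -rM mulVg r1. Qed.

Lemma rKV g : cancel (r g^-1%g) (r g).
Proof. by move=> x; rewrite -rM mulgV r1. Qed.

Lemma lVK g : cancel (l g) (l g^-1%g).
Proof. by move=> x; rewrite -lM mulVg l1. Qed.

Lemma lKV g : cancel (l g^-1%g) (l g).
Proof. by move=> x; rewrite -lM mulgV l1. Qed.

Lemma free_inj x : injective (r ^~ x).
Proof.
move=> g h e; apply: (mulgI h^-1%g); rewrite mulVg; apply: (@r_free _ x).
by rewrite rM e rVK.
Qed.

(** Orbit maps are injective by freeness. All finiteness arguments on orbits below rest on this. *)
Lemma finite_hits (T : Type) (phi : T -> G) (K : set X) x :
  injective phi -> finite_set K -> finite_set [set t | K (r (phi t) x)].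
Proof.
move=> phi_inj; apply: (@finite_preimage _ _ K (fun t => r (phi t) x)).
by move=> s t _ _ /free_inj/phi_inj.
Qed.

Section Z2.
Variable f : int * int -> G.
Hypothesis f_inj : injective f.
Hypothesis fD : forall u v, f (u + v) = (f u * f v)%g.

Let a := f (1, 0).
Let b := f (0, 1).
Let pa (n : nat) := f (n%:Z, 0).
Let pb (n : nat) := f (0, n%:Z).

Let f0 : f 0 = 1%g.
Proof. by apply: (mulgI (f 0)); rewrite mulg1 -fD addr0. Qed.

Let fC u v : (f u * f v)%g = (f v * f u)%g.
Proof. by rewrite -!fD addrC. Qed.

Let fV u : f (- u) = (f u)^-1%g.
Proof. by apply: (mulIg (f u)); rewrite mulVg -fD addNr f0. Qed.

Let paS n : pa n.+1 = (a * pa n)%g.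
Proof. by rewrite -fD; congr f; apply: injective_projections => /=; lia. Qed.

Let pbS n : pb n.+1 = (b * pb n)%g.
Proof. by rewrite -fD; congr f; apply: injective_projections => /=; lia. Qed.

Let pa_inj : injective pa.
Proof. by move=> m n /f_inj []. Qed.

(* [eventual x y] says that [y = lim l (a ^- n) (r (a ^+ n) x)], the sequence
   being eventually constant. *)
Definition eventual x y :=
  exists N, forall n, (N <= n)%N -> l (pa n) y = r (pa n) x.

Let eventually_avoids K x : finite_set K ->
  exists N, forall n, (N <= n)%N -> ~ K (r (pa n) x).
Proof.
move=> /(finite_hits x pa_inj)/finite_set_nat_bound[N hN]; exists N => n Nn Kn.
by have := hN n Kn; rewrite ltnNge Nn.
Qed.

Let eventual_ex x : exists y, eventual x y.
Proof.
have [N hN] := eventually_avoids x (rl_fin a).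
(* Beyond [N] the orbit avoids the points where [r a] and [l a] differ, so the sequence stays
   constant. *)
exists (l (pa N)^-1%g (r (pa N) x)); exists N => n /subnK <-.
elim: (n - N)%N => [|k IH]; first by rewrite add0n lKV.
rewrite addSn paS lM rM IH; symmetry; apply: contrapT => h.
by apply: (hN _ _ h); rewrite leq_addl.
Qed.

Let eventual_uniq x y z : eventual x y -> eventual x z -> y = z.
Proof.
move=> [N hN] [M hM]; have h1 := hN _ (leq_maxl N M).
by have h2 := hM _ (leq_maxr N M); rewrite -[y](lVK (pa (maxn N M))) h1 -h2 lVK.
Qed.

(** [f u] commutes with the powers of [a], and far along the orbit [r] and [l] agree on [f u]. *)
Let eventual_comm u x y : eventual x y -> eventual (r (f u) x) (l (f u) y).
Proof.
move=> [N hN]; have [M hM] := eventually_avoids x (rl_fin (f u)).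
exists (maxn N M) => n; rewrite geq_max => /andP[Nn Mn].
by rewrite -lM -rM /pa !(fC _ u) lM rM hN //; symmetry; apply: contrapT => /hM; apply.
Qed.

Lemma ex_intertwiner : exists theta : X -> X,
  [/\ injective theta, finite_set [set x | theta x <> x] & intertwines theta a].
Proof.
have [theta thetaP] := choice eventual_ex.
have theta_f u x : theta (r (f u) x) = l (f u) (theta x).
  exact: eventual_uniq (thetaP _) (eventual_comm u (thetaP x)).
exists theta; split; last exact: theta_f.
  move=> x y; have [[N hN] [M hM]] := (thetaP x, thetaP y) => exy.
  rewrite -[x](rVK (pa (maxn N M))) -hN ?leq_maxl // exy.
  by rewrite hM ?leq_maxr // rVK.
pose D := [set x | r a x <> l a x]; pose Db := [set x | r b x <> l b x].
(* If the forward [a]-orbit of [x] avoids [D], then [r] and [l] agree along it and the limit is [x]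
   itself. *)
have hitsD x : theta x <> x -> exists k, D (r (pa k) x).
  move=> nx; apply: contrapT => nD; apply: nx.
  apply: eventual_uniq (thetaP x) _; exists 0%N => n _.
  elim: n => [|n IH]; first by rewrite /pa f0 r1 l1.
  by rewrite paS lM rM IH; symmetry; apply: contrapT => h; apply: nD; exists n.
(* A moved point is thus reached from the finite set [D] by going back [k] steps; only the number of
   such [k] has to be bounded. *)
pose S d := [set k : nat | theta (r (pa k)^-1%g d) <> r (pa k)^-1%g d].
suff Sfin d : finite_set (S d).
  apply: (@sub_finite_set _ _
    (\bigcup_(d in D) (fun k => r (pa k)^-1%g d) @` S d)).
    move=> x /= nx; have [k Dk] := hitsD x nx.
    by exists (r (pa k) x) => //; exists k; rewrite /S /= rVK.
  by apply: bigcup_finite => [|d _]; [exact: rl_fin | exact: finite_image].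
(* Only finitely many [k] have some [a^-k b^m d] in [Db], as these group elements are pairwise
   distinct. No other [k] can occur. *)
apply: (@sub_finite_set _ _ (snd @` [set mk : nat * nat |
    Db (r (f (- mk.2%:Z, mk.1%:Z)) d)])); last first.
  apply: finite_image; apply: finite_hits (rl_fin b) => -[m k] [m' k'] /f_inj /=.
  by move=> [] *; congr pair; lia.
move=> k Sk; apply: contrapT => nK; pose x := r (pa k)^-1%g d.
have nDb m : ~ Db (r (pb m) x).
  move=> h; apply: nK; exists (m, k) => //=.
  have <- : (0, m%:Z) + - (k%:Z, 0) = (- k%:Z, m%:Z).
    by apply: injective_projections => /=; lia.
  by rewrite fD fV rM.
(* [r b] and [l b] agree along this [b]-orbit, so [theta] moves all of its points. *)
have Mb m : theta (r (pb m) x) <> r (pb m) x.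
  elim: m => [|m IH]; first by rewrite /pb f0 r1.
  rewrite pbS rM theta_f => e; apply: IH.
  have : r b (r (pb m) x) = l b (r (pb m) x) by apply: contrapT; exact: nDb.
  by move=> h; rewrite h in e; exact: (can_inj (lVK b) e).
(* Each moved point [b^m x] reaches [D] along its [a]-orbit. The elements [a^(kk m) b^m] are
   distinct, which gives infinitely many hits of a finite set. *)
have [kk hkk] := choice (fun m => hitsD _ (Mb m)).
have : finite_set [set m | D (r (pa (kk m) * pb m)%g x)].
  apply: finite_hits (rl_fin a) => m n.
  by rewrite -!fD => /f_inj [] *; lia.
rewrite (_ : [set m | _] = setT); first exact: infinite_nat.
by apply/seteqP; split=> // m _ /=; rewrite rM.
Qed.

End Z2.

Lemma intertwines_of_conj theta g h : torsion_free G ->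
  finite_set [set x | theta x <> x] ->
  intertwines theta h -> h <> 1%g -> intertwines theta (g * h * g^-1)%g ->
  intertwines theta g.
Proof.
move=> tf fin_theta th h1 tghg x; apply: contrapT => Bx.
pose Bad := [set x | theta (r g x) <> l g (theta x)].
have Bfin : finite_set Bad.
  (* Outside this union [theta] fixes both the point and its image by [r g], and [r g] agrees with
     [l g]. *)
  apply: (@sub_finite_set _ _ ([set x | theta x <> x] `|`
    (r g^-1%g @` [set x | theta x <> x]) `|` [set x | r g x <> l g x])).
    move=> y By; have [?|ty] := pselect (theta y <> y); first by left; left.
    have [tgy|tgy] := pselect (theta (r g y) <> r g y).
      by left; right; exists (r g y) => //; rewrite rVK.
    right => e; apply: By; move: ty tgy => /contrapT -> /contrapT ->; exact: e.
  rewrite !finite_setU; split; last exact: rl_fin.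
  by split => //; apply: finite_image.
(* If [r h y] were not bad, evaluating the relation for [g h g^-1] at [r g y] and cancelling [l g]
   and [l h] would show that [y] is not bad. *)
have BadS y : Bad y -> Bad (r h y).
  move=> By e; apply: By; have := tghg (r g y).
  rewrite -rM -!mulgA mulVg mulg1 rM e th !lM => e'.
  have {}e' := can_inj (lVK _) (can_inj (lVK _) e').
  by rewrite -[LHS](lKV g) -e'.
have Badn n : Bad (r (h ^+ n)%g x).
  by elim: n => [|n IH]; rewrite ?expg0 ?r1 // expgS rM; exact: BadS.
have : finite_set [set n | Bad (r (h ^+ n)%g x)].
  by apply: finite_hits => //; exact: expg_inj_of_torsion_free.
rewrite (_ : [set m | _] = setT); first exact: infinite_nat.
by apply/seteqP; split=> // m _; exact: Badn.
Qed.

Lemma intertwinesV theta g : intertwines theta g -> intertwines theta g^-1%g.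
Proof. by move=> tg x; rewrite -[x in RHS](rKV g) tg lVK. Qed.

Lemma intertwinesM theta g h :
  intertwines theta g -> intertwines theta h -> intertwines theta (g * h)%g.
Proof. by move=> tg th x; rewrite rM tg th lM. Qed.

Lemma intertwinesX theta g n : intertwines theta g -> intertwines theta (g ^+ n)%g.
Proof.
move=> tg; elim: n => [|n IH]; first by move=> x; rewrite expg0 r1 l1.
by rewrite expgS; apply: intertwinesM.
Qed.

End AlmostEqualActions.

(** * Gluing the cut circle *)

Section Subdivision.
Variable R : realType.
Implicit Types (s : nat -> R) (N l : nat) (u : R).

Lemma locate s N u : s 0%N <= u < s N ->
  exists2 l, (l < N)%N & s l <= u < s l.+1.
Proof.
elim: N => [/andP[h1 h2]|N IH /andP[h1 h2]]; first lra.
have [uN|Nu] := ltP u (s N); last by exists N; rewrite // Nu.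
by have [|l lN h] := IH; [rewrite h1 | exists l => //; exact: leqW].
Qed.

Lemma subdivision_le s N : (forall l, (l < N)%N -> s l < s l.+1) ->
  forall l l', (l <= l' <= N)%N -> s l <= s l'.
Proof.
move=> mono l l' /andP[]; elim: l' => [|l' IH].
  by rewrite leqn0 => /eqP->.
rewrite leq_eqVlt => /orP[/eqP-> //|ll' l'N].
by rewrite (le_trans (IH ll' (ltnW l'N))) // ltW // mono.
Qed.

Lemma locate_uniq s N l l' : (forall l, (l < N)%N -> s l < s l.+1) ->
  (l < N)%N -> (l' < N)%N -> s l < s l'.+1 -> s l' < s l.+1 -> l = l'.
Proof.
move=> mono lN l'N h h'; have le := subdivision_le mono.
case: (ltngtP l l') => // ll'.
  by have := le l.+1 l'; rewrite ll' ltnW // => /(_ isT); rewrite leNgt h'.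
by have := le l'.+1 l; rewrite ll' ltnW // => /(_ isT); rewrite leNgt h.
Qed.

End Subdivision.

(* [len i] is the length of a piece and [prev i] the piece glued to its left;
   [circ_of i] is then the circle containing the piece [i], and [off i] its
   offset in that circle. *)
Lemma cyclic_layout (R : realType) (m : nat) (len : 'I_m -> R)
    (prev : 'I_m -> 'I_m) :
  (0 < m)%N -> (forall i, 0 < len i) -> injective prev ->
  exists (n : nat) (circ_of : 'I_m -> 'I_n) (off : 'I_m -> R) (L : 'I_n -> R),
    [/\ (0 < n)%N, forall k, 0 < L k, \sum_k L k = \sum_i len i &
     [/\ forall i, 0 <= off i /\ off i + len i <= L (circ_of i),
      forall k u, 0 <= u < L k ->
        exists2 i, circ_of i = k & off i <= u < off i + len i,
      forall i i', circ_of i = circ_of i' -> off i < off i' + len i' ->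
        off i' < off i + len i -> i = i',
      forall i, circ_of (prev i) = circ_of i &
      forall i, off i = off (prev i) + len (prev i) \/
        off i = 0 /\ off (prev i) + len (prev i) = L (circ_of i)]].
Proof.
(* [tau] sends a piece to its right neighbour, so its orbits are listed from left to right. *)
move=> m0 len0 prev_inj; pose tau := finv prev.
have tau_inj : injective tau by exact: finv_inj.
have sym : connect_sym (frel tau) by exact: fconnect_sym.
(* The circles are the orbits of [tau], numbered through their roots; the root is the piece at
   offset 0. *)
pose i0 := froot tau (Ordinal m0).
have i0P : i0 \in froots tau by exact: (roots_root sym).
pose n := #|froots tau|.
pose circ_of i : 'I_n := enum_rank_in i0P (froot tau i).
pose rt (k : 'I_n) : 'I_m := enum_val k.
have rtK i : rt (circ_of i) = froot tau i.
  by rewrite /rt enum_rankK_in //; exact: (roots_root sym).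
have conn i : fconnect tau (rt (circ_of i)) i by rewrite rtK sym connect_root.
have circ_ofE k i : (circ_of i == k) = fconnect tau (rt k) i.
  rewrite -(root_connect sym) (eqP (enum_valP k : rt k \in froots tau)).
  apply/eqP/eqP => [<-|e]; first by rewrite rtK.
  by apply: enum_val_inj; rewrite -[LHS]/(rt _) rtK -e.
pose S r l : R := \sum_(j < l) len (iter j tau r).
have SS r l : S r l.+1 = S r l + len (iter l tau r) by rewrite /S big_ord_recr.
have S0 r : S r 0%N = 0 by rewrite /S big_ord0.
have mono r N l : (l < N)%N -> S r l < S r l.+1 by rewrite SS ltrDl.
have Sle r N := subdivision_le (mono r N).
pose fi i := findex tau (rt (circ_of i)) i.
have fiK i : iter (fi i) tau (rt (circ_of i)) = i by exact: iter_findex.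
have fi_lt i : (fi i < order tau (rt (circ_of i)))%N by exact: findex_max.
pose off i := S (rt (circ_of i)) (fi i).
pose L (k : 'I_n) := S (rt k) (order tau (rt k)).
have offS i : off i + len i = S (rt (circ_of i)) (fi i).+1 by rewrite SS fiK.
have circ_prev i : circ_of (prev i) = circ_of i.
  apply/eqP; rewrite circ_ofE; apply: connect_trans (conn i) _.
  by rewrite sym; apply: connect1; rewrite /= /tau finv_f.
exists n, circ_of, off, L; split.
- by apply/card_gt0P; exists i0.
- move=> k; rewrite -(S0 (rt k)); have o0 := order_gt0 tau (rt k).
  apply: (lt_le_trans (mono _ _ _ o0)); apply: (Sle _ (order tau (rt k))).
  by rewrite o0 leqnn.
- rewrite (partition_big circ_of xpredT) //=; apply: eq_bigr => k _.
  rewrite (eq_bigl (mem (orbit tau (rt k)))); last first.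
    by move=> i /=; rewrite circ_ofE fconnect_orbit.
  rewrite -big_uniq ?orbit_uniq // (big_nth (rt k)) size_traject big_mkord.
  by apply: eq_bigr => j _; rewrite nth_traject.
split.
- move=> i; split.
    by rewrite -(S0 (rt (circ_of i))); apply: (Sle _ (fi i)); rewrite leqnn.
  rewrite offS; apply: (Sle _ (order tau (rt (circ_of i)))).
  by rewrite fi_lt leqnn.
- move=> k u /andP[u0 uL]; have [|l lo] := @locate R (S (rt k)) (order tau (rt k)) u.
    by rewrite S0 u0.
  have ck : circ_of (iter l tau (rt k)) = k.
    by apply/eqP; rewrite circ_ofE fconnect_iter.
  have fk : fi (iter l tau (rt k)) = l by rewrite /fi ck findex_iter.
  by exists (iter l tau (rt k)) => //; rewrite offS /off ck fk.
- move=> i i' e; rewrite !offS /off e => h1 h2.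
  rewrite -(fiK i) -(fiK i') e; congr (iter _ _ _).
  apply: (@locate_uniq _ _ (order tau (rt (circ_of i')))) h1 h2 => //.
    exact: mono.
  by rewrite -e.
- exact: circ_prev.
move=> i; rewrite offS circ_prev /off.
have e : iter (fi (prev i)).+1 tau (rt (circ_of i)) = i.
  by rewrite -(circ_prev i) iterS fiK /tau finv_f.
(* Either [prev i] ends its orbit and [i] is the root, or [i] comes one index later. *)
have := fi_lt (prev i); rewrite circ_prev leq_eqVlt => /orP[/eqP eo|lo].
  right; split; last by rewrite eo.
  have {}e : i = rt (circ_of i) by rewrite -[LHS]e eo iter_order.
  by rewrite /fi -e findex0 S0.
by left; rewrite {1}/fi -[X in findex _ _ X]e findex_iter.
Qed.

(** * Bijections with prescribed affine pieces *)

Section Exchange.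
Variable R : realType.
Implicit Types (x y : I01 R) (r t u : R).

Lemma bijection_of (T : Type) (f : T -> T) :
  injective f -> (forall y : T, exists x : T, f x = y) ->
  exists b : bijection T, forall x : T, b x = f x.
Proof.
move=> f_inj /choice[g fg].
have gf : cancel f g by move=> x; apply: f_inj; rewrite fg.
by exists (Bijection gf fg).
Qed.

Lemma circ0_1 : circ 1 = circ 0 :> I01 R.
Proof. by rewrite -[1 in LHS]add0r -[1]/(1%:~R) circDz. Qed.

(** The circle is cut at 0 and at the moved points; the piece ending at [theta (p i)] becomes the
    left neighbour of the piece starting at [p i]. *)
Lemma break_points (theta : I01 R -> I01 R) :
  injective theta -> finite_set [set x | theta x <> x] ->
  exists (m : nat) (p : nat -> R) (prev : 'I_m -> 'I_m),
    [/\ (0 < m)%N, p 0%N = 0, p m = 1, forall i, (i < m)%N -> p i < p i.+1 &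
     [/\ injective prev,
      forall i : 'I_m, theta (circ (p i)) = circ (p (prev i).+1) &
      forall x, (forall i : 'I_m, pos x <> p i) -> theta x = x]].
Proof.
move=> theta_inj /finite_seqP[s sP].
have movedE x : theta x <> x <-> x \in s.
  by rewrite -[_ <> _]/([set x | theta x <> x] x) sP.
pose q : seq R := sort <=%R (undup (0 :: [seq pos x | x <- s])).
have qE r : (r \in q) = (r == 0) || (r \in [seq pos x | x <- s]).
  by rewrite mem_sort mem_undup inE.
have q_sorted : sorted <%R q by rewrite sort_lt_sorted undup_uniq.
have q_itv r : r \in q -> 0 <= r < 1.
  rewrite qE => /orP[/eqP->|/mapP[x _ ->]]; last exact: I01P.
  by rewrite lexx ltr01.
have q0 : 0 \in q by rewrite qE eqxx.
(* The default value 1 supplies the last end point [p m]. *)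
pose p i := nth 1 q i; pose m := size q.
have m0 : (0 < m)%N by rewrite /m; case: (q) q0.
have p_in i : (i < m)%N -> p i \in q by move=> im; rewrite mem_nth.
have p_ex r : r \in q -> exists2 i, (i < m)%N & p i = r.
  by move=> rq; exists (index r q); rewrite ?index_mem // /p nth_index.
have p_mono i j : (i < m)%N -> (j < m)%N -> (p i < p j) = (i < j)%N.
  by move=> im jm; apply: (lt_sorted_ltn_nth 1 q_sorted).
have p0 : p 0%N = 0.
  have [i im pi0] := p_ex 0 q0; have /q_itv/andP[p0 _] := p_in 0%N m0.
  by apply: le_anti; rewrite p0 andbT leNgt -{1}pi0 p_mono.
have pm : p m = 1 by rewrite /p nth_default.
have p_itv i : (i < m)%N -> 0 <= p i < 1 by move=> /p_in/q_itv.
have p_step i : (i < m)%N -> p i < p i.+1.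
  move=> im; have [im'|mi] := ltnP i.+1 m; first by rewrite p_mono.
  have -> : i.+1 = m by apply/eqP; rewrite eqn_leq mi im.
  by rewrite pm; case/andP: (p_itv i im).
(* By injectivity, if [theta] fixes [theta x] then it fixes [x]; otherwise [theta x] is a moved
   point, hence a cut. *)
have next i : (i < m)%N -> pos (theta (circ (p i))) \in q.
  move=> im; pose x := circ (p i).
  have [e|/movedE ne] := pselect (theta (theta x) = theta x).
    by rewrite (theta_inj _ _ e) circ_id ?p_itv ?p_in.
  by rewrite qE map_f ?orbT.
have /fin_all_exists[prev prevP] (i : 'I_m) :
    exists j : 'I_m, theta (circ (p i)) = circ (p j.+1).
  have [[|j] jm jP] := p_ex _ (next i (ltn_ord i)).
    (* The image is 0, which on the circle is the right end 1 of the last piece. *)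
    have mm : (m.-1 < m)%N by rewrite prednK.
    exists (Ordinal mm); rewrite /= prednK // pm circ0_1.
    by rewrite -[LHS]circK -jP p0.
  by exists (Ordinal (ltnW jm)); rewrite /= jP circK.
exists m, p, prev; split => //; split => //.
  move=> i i' e; have := prevP i; rewrite e -prevP => /theta_inj/(congr1 (@pos R)).
  rewrite !circ_id ?p_itv // => /eqP; rewrite nth_uniq //.
    by move/eqP/val_inj.
  exact: lt_sorted_uniq.
move=> x xp; apply: contrapT => /movedE xs.
have [|i im] := p_ex (pos x); first by rewrite qE map_f ?orbT.
by move/esym; exact: (xp (Ordinal im)).
Qed.

Lemma piecewise_impl (P Q : (I01 R -> R) -> set (I01 R) -> Prop) (f : I01 R -> I01 R) :
  (forall g D, P g D -> Q g D) -> piecewise P f -> piecewise Q f.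
Proof. by move=> PQ [s ps H]; exists s => // i /H; exact: PQ. Qed.

(** The image pieces tile the interval: [cover] gives surjectivity and the last hypothesis
    injectivity. This builds both the exchange (slopes 1) and the rescaling map. *)
Lemma affine_exchange (m : nat) (p : nat -> R) (e c : 'I_m -> R) :
  let len i := c i * (p i.+1 - p i) in
  p 0%N = 0 -> p m = 1 -> (forall i, (i < m)%N -> p i < p i.+1) ->
  (forall i, 0 < c i) -> (forall i, 0 <= e i /\ e i + len i <= 1) ->
  (forall u, 0 <= u < 1 -> exists i, e i <= u < e i + len i) ->
  (forall i i', e i < e i' + len i' -> e i' < e i + len i -> i = i') ->
  exists b : bijection (I01 R),
    (forall (i : 'I_m) x, p i <= pos x < p i.+1 ->
       pos (b x) = e i + c i * (pos x - p i)) /\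
    piecewise (fun f D => exists i, forall x, D x ->
      f x = c i * pos x + (e i - c i * p i)) b.
Proof.
move=> len p0 pm p_step c0 eP cover disj.
have idx_ex x : exists i : 'I_m, p i <= pos x < p i.+1.
  have [|i im h] := @locate R p m (pos x); first by rewrite p0 pm I01P.
  by exists (Ordinal im).
have [idx idxP] := choice idx_ex.
have idxE (i : 'I_m) x : p i <= pos x < p i.+1 -> idx x = i.
  move=> /andP[h1 h2]; have /andP[h3 h4] := idxP x; apply: val_inj.
  by apply: (locate_uniq p_step); rewrite ?ltn_ord //; lra.
pose v x := e (idx x) + c (idx x) * (pos x - p (idx x)).
have vP x : e (idx x) <= v x < e (idx x) + len (idx x).
  have /andP[h3 h4] := idxP x; rewrite /v /len lerDl ltrD2l ltr_pM2l // ltrD2r h4.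
  by rewrite mulr_ge0 ?subr_ge0 // ltW.
have v01 x : 0 <= v x < 1.
  by have /andP[h1 h2] := vP x; have [h3 h4] := eP (idx x); lra.
pose f x := circ (v x).
have f_inj : injective f.
  move=> x y /(congr1 (@pos R)); rewrite !circ_id // => vxy.
  have /andP[h1 h2] := vP x; have /andP[h3 h4] := vP y.
  have ixy : idx x = idx y by apply: disj; lra.
  apply: pos_inj; move: vxy; rewrite /v ixy => /addrI/mulfI h.
  by apply: (@addIr _ (- p (idx y))); apply: h; rewrite gt_eqF.
have f_surj y : exists x, f x = y.
  have [i /andP[h1 h2]] := cover (pos y) (I01P y).
  pose w := p i + (pos y - e i) / c i.
  have iw : p i <= w < p i.+1.
    rewrite /w lerDl divr_ge0 ?subr_ge0 ?(ltW (c0 i)) //= -ltrBrDl ltr_pdivrMr //.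
    by rewrite mulrC ltrBlDl.
  have pw : pos (circ w) = w.
    rewrite circ_id //; have := @subdivision_le _ p m p_step 0 i.
    have := @subdivision_le _ p m p_step i.+1 m.
    by rewrite p0 pm ltn_ord leqnn (ltnW (ltn_ord i)) => /(_ isT) ? /(_ isT); lra.
  exists (circ w); rewrite /f /v (@idxE i) pw // -[RHS]circK; congr circ.
  by rewrite /w [p i + _]addrC addrK mulrC divfK ?gt_eqF // addrC subrK.
have [b bP] := bijection_of f_inj f_surj.
have bE (i : 'I_m) x : p i <= pos x < p i.+1 ->
    pos (b x) = e i + c i * (pos x - p i).
  by move=> ix; rewrite bP circ_id // /v (idxE i).
exists b; split=> //.
apply: (@piecewise_of_breaks _ _ _ [seq p i | i <- iota 0 m.+1]) => u u' u0 uu' u'1 H.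
have u01 : 0 <= u < 1 by lra.
have := idxP (circ u); set i := idx _; rewrite circ_id // => /andP[h1 h2].
exists i => x /andP[ux xu'].
have up : u' <= p i.+1.
  rewrite leNgt; apply/negP => h; have := H (p i.+1).
  rewrite h2 h map_f ?mem_iota /= => [/(_ isT)|]; first by [].
  by rewrite add0n ltnS ltn_ord.
rewrite -[LHS]/(pos (b x)) (bE i); first by ring.
move: ux xu'; rewrite -/(pos x) => *; lra.
Qed.

(** Values slightly below and above [f x] are attained, at points which by monotonicity bound a
    suitable neighbourhood of [x]. *)
Lemma increasing_continuous (f : I01 R -> I01 R) :
  (forall x y, pos x < pos y -> pos (f x) < pos (f y)) ->
  (forall y, exists x, f x = y) -> continuous f.
Proof.
move=> f_inc f_surj; apply: continuous_comp_initial => x A /nbhs_ballP[eps /= eps0 epsA].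
have lowP : exists2 z : R, z < pos x & forall y, z < pos y -> pos (f x) - eps < pos (f y).
  (* When [f x] is 0 no value lies below it, and any lower bound will do. *)
  have [h|h] := ltP 0 (pos (f x)); last first.
    exists (pos x - 1); first lra.
    by move=> y _; have := I01_ge0 (f y); lra.
  pose a := Num.max 0 (pos (f x) - eps / 2).
  have aa : 0 <= a < pos (f x) by rewrite /a le_max lexx gt_max h /=; lra.
  have a1 : pos (f x) - eps < a by rewrite /a lt_max; apply/orP; right; lra.
  have [z fz] := f_surj (circ a).
  have pz : pos (f z) = a by rewrite fz circ_id //; have := I01_lt1 (f x); lra.
  exists (pos z).
    rewrite ltNge le_eqVlt; apply/negP => /orP[/eqP/pos_inj e|/f_inc]; last lra.
    by move: aa; rewrite -pz e; lra.
  by move=> y /f_inc; lra.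
have highP : exists2 z : R, pos x < z & forall y, pos y < z -> pos (f y) < pos (f x) + eps.
  have fx1 := I01_lt1 (f x); have fx0 := I01_ge0 (f x).
  pose a := Num.min ((1 + pos (f x)) / 2) (pos (f x) + eps / 2).
  have aa : pos (f x) < a < 1.
    rewrite /a lt_min gt_min; apply/andP; split; first by apply/andP; split; lra.
    by apply/orP; left; lra.
  have a1 : a < pos (f x) + eps by rewrite /a gt_min; apply/orP; right; lra.
  have [z fz] := f_surj (circ a).
  have pz : pos (f z) = a by rewrite fz circ_id //; lra.
  exists (pos z).
    rewrite ltNge le_eqVlt; apply/negP => /orP[/eqP/pos_inj e|/f_inc]; last lra.
    by move: aa; rewrite -pz e; lra.
  by move=> y /f_inc; lra.
case: lowP => zl zlx lowP; case: highP => zh zhx highP.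
have d0 : 0 < Num.min (pos x - zl) (zh - pos x) by rewrite lt_min !subr_gt0 zlx.
have := @initial_continuous _ _ (@pos R) x _ (nbhsx_ballx (pos x) _ d0).
apply: (@filterS _ _ (nbhs_filter x)) => y.
rewrite /= /ball /= lt_min => /andP[yl yh]; apply: epsA.
rewrite /ball /= -/(pos (f y)) -/(pos (f x)).
move: yl yh; rewrite !ltr_distlC => /andP[? ?] /andP[? ?].
have h1 : pos (f x) - eps < pos (f y) by apply: lowP; lra.
have h2 : pos (f y) < pos (f x) + eps by apply: highP; lra.
by apply/andP; split.
Qed.

Lemma increasing_homeo (b : bijection (I01 R)) :
  (forall x y, pos x < pos y -> pos (b x) < pos (b y)) ->
  continuous (bij_fun b) /\ continuous (bij_inv b).
Proof.
move=> b_inc; split; apply: increasing_continuous => //.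
- by move=> y; exists (bij_inv b y); rewrite bij_invK.
- move=> x y xy; rewrite ltNge le_eqVlt; apply/negP => /orP[/eqP/pos_inj e|/b_inc].
    by move: xy; rewrite -(bij_invK b x) -e bij_invK ltxx.
  by rewrite !bij_invK; lra.
- by move=> y; exists (b y); rewrite bij_funK.
Qed.

End Exchange.

(** * The union of circles defined by [theta] *)

Section Decomposition.
Variable R : realType.
Implicit Types (x y : I01 R) (r t u : R) (n : nat).

Lemma mod_inv_itv n t : (0 < n)%N -> 0 <= mod_inv n t < 1 / n%:R.
Proof.
move=> n0; have nR : 0 < n%:R :> R by rewrite ltr0n.
have /andP[h1 h2] := floor_itv (n%:R * t).
rewrite /mod_inv subr_ge0 ler_pdivrMr // [t * _]mulrC h1 /=.
rewrite ltrBlDr -mulrDl ltr_pdivlMr // [t * _]mulrC.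
by rewrite intrD addrC in h2.
Qed.

Lemma mod_inv_id n t : (0 < n)%N -> 0 <= t < 1 / n%:R -> mod_inv n t = t.
Proof.
move=> n0 /andP[t0 t1]; have nR : 0 < n%:R :> R by rewrite ltr0n.
rewrite /mod_inv (@floor_def _ _ 0) ?mul0r ?subr0 // mulr_ge0 ?ler0n //=.
by rewrite add0r mulrC -ltr_pdivlMr.
Qed.

Lemma mod_invDz n t (z : int) : (0 < n)%N -> mod_inv n (t + z%:~R / n%:R) = mod_inv n t.
Proof.
move=> n0; have nR : n%:R != 0 :> R by rewrite pnatr_eq0 -lt0n.
rewrite /mod_inv mulrDr mulrCA mulfV // mulr1 floorDrz // intrKfloor intrD mulrDl.
by rewrite opprD addrACA subrr addr0.
Qed.

Lemma mod_inv_eq n s t : mod_inv n s = mod_inv n t -> exists z : int, s = t + z%:~R / n%:R.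
Proof.
rewrite /mod_inv => h; exists (Num.floor (n%:R * s) - Num.floor (n%:R * t)).
by rewrite intrB mulrBl; lra.
Qed.

(* [Phi] identifies [I01 R] with [n] circles of lengths [L k], rescaled to
   length [1/n] and cut open; [line Phi L k] is the unit speed
   parametrisation of the [k]-th one. *)
Definition line n (Phi : bijection (I01 R)) (L : 'I_n -> R) (k : 'I_n) u :=
  bij_inv Phi (circ (k%:R / n%:R + mod_inv n (u / (n%:R * L k)))).

Lemma lineDz n Phi (L : 'I_n -> R) k u (z : int) : 0 < L k ->
  line Phi L k (u + z%:~R * L k) = line Phi L k u.
Proof.
move=> L0; have n0 : (0 < n)%N by case: n k {L L0} => [[]|].
have X : (u + z%:~R * L k) / (n%:R * L k) = u / (n%:R * L k) + z%:~R / n%:R.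
  by field; rewrite pnatr_eq0 -lt0n n0 gt_eqF.
by rewrite /line X mod_invDz.
Qed.

Lemma line_reduce n Phi (L : 'I_n -> R) k u : 0 < L k ->
  exists2 v, 0 <= v < L k & forall d, line Phi L k (u + d) = line Phi L k (v + d).
Proof.
move=> L0; exists (u - (Num.floor (u / L k))%:~R * L k).
  have /andP[h1 h2] := floor_itv (u / L k).
  rewrite subr_ge0 -ler_pdivlMr // h1 /= ltrBlDr.
  by move: h2; rewrite intrD ltr_pdivrMr // mulrDl mul1r addrC.
move=> d; rewrite -(@lineDz _ _ _ _ (u - _ + d) (Num.floor (u / L k))) //.
by congr line; ring.
Qed.

(** Running backwards along a circle from [x], one arrives on the left side of [theta x]: this is
    the gluing encoded by [prev]. *)
Lemma circle_decomposition (theta : I01 R -> I01 R) :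
  injective theta -> finite_set [set x | theta x <> x] ->
  exists (n : nat) (E P : bijection (I01 R)) (L : 'I_n -> R),
    [/\ (0 < n)%N, IET E, PL_homeo P, forall k, 0 < L k &
     forall k u, exists2 e : R, 0 < e & forall d : R, 0 < d < e ->
       line (P * E)%g L k (u + d) = rotate d (line (P * E)%g L k u) /\
       line (P * E)%g L k (u - d) = rotate (- d) (theta (line (P * E)%g L k u))].
Proof.
move=> theta_inj /(break_points theta_inj).
move=> [m [p [prev [m0 p0 pm p_step [prev_inj theta_p theta_id]]]]].
pose len (i : 'I_m) := p i.+1 - p i.
have len0 i : 0 < len i by rewrite subr_gt0 p_step.
have [n [co [off [L [n0 L0 sumL [offP cover disj co_prev off_prev]]]]]] :=
  cyclic_layout m0 len0 prev_inj.
have nR : 0 < n%:R :> R by rewrite ltr0n.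
have {}sumL : \sum_k L k = 1.
  rewrite sumL -(big_mkord xpredT (fun i => p i.+1 - p i)) telescope_sumr //.
  by rewrite p0 pm subr0.
have ple := subdivision_le p_step.
have p01 (i : 'I_m) : 0 <= p i /\ p i + len i <= 1.
  split; first by rewrite -p0; apply: ple; rewrite leq0n ltnW.
  by rewrite /len addrC subrK -pm; apply: ple; rewrite ltn_ord leqnn.
(* [C l] is the point where the [l]-th circle starts once all circles are laid end to end. *)
pose Lx l := if insub l is Some k then L k else 0.
pose C l := \sum_(j < l) Lx j.
have CS (k : 'I_n) : C k.+1 = C k + L k by rewrite /C big_ord_recr /= /Lx valK.
have C0 : C 0%N = 0 by rewrite /C big_ord0.
have Cn : C n = 1 by rewrite -sumL /C; apply: eq_bigr => k _; rewrite /Lx valK.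
have C_step l : (l < n)%N -> C l < C l.+1.
  by move=> ln; rewrite (CS (Ordinal ln)) ltrDl.
have Cle := subdivision_le C_step.
have C01 (k : 'I_n) : 0 <= C k /\ C k + L k <= 1.
  by split; rewrite -?C0 -?CS -?Cn; apply: Cle; rewrite ?leq0n ?leqnn ?ltn_ord // ltnW.
(* [E] translates each piece to its offset inside its circle. *)
have [|i|u u01|i i' h1 h2|E [EE E_pw]] := @affine_exchange R m p
    (fun i => C (co i) + off i) (fun=> 1) p0 pm p_step.
- by [].
- have [h1 h2] := offP i; have [h3 h4] := C01 (co i).
  by move: h2; rewrite mul1r -/(len i) => *; split; lra.
- have [|l ln lu] := @locate R C n u; first by rewrite C0 Cn.
  pose k := Ordinal ln; have [|i ik iu] := cover k (u - C l).
    by move: lu; rewrite (CS k) /=; lra.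
  by exists i; rewrite ik mul1r -/(len i) /=; lra.
- move: h1 h2; rewrite !mul1r -/(len i) -/(len i') => h1 h2.
  have [g1 g2] := offP i; have [g3 g4] := offP i'.
  have e : co i = co i'.
    by apply: val_inj; apply: (locate_uniq C_step); rewrite ?ltn_ord // CS; lra.
  by apply: disj; rewrite // ?e in h1 h2 *; lra.
pose q l : R := l%:R / n%:R.
have qS l : q l.+1 = q l + 1 / n%:R by rewrite /q -natr1 mulrDl.
have q_step l : (l < n)%N -> q l < q l.+1 by rewrite qS ltrDl divr_gt0.
have qn : q n = 1 by rewrite /q divff ?gt_eqF.
have qle := subdivision_le q_step.
have nL k : (n%:R * L k)^-1 * (C k.+1 - C k) = 1 / n%:R.
  by rewrite CS [C k + _]addrC addrK invfM -mulrA mulVf ?gt_eqF // mulr1 div1r.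
have nL0 k : 0 < (n%:R * L k)^-1 by rewrite invr_gt0 mulr_gt0.
(* [P] rescales the [k]-th circle from length [L k] to [1/n], keeping the order of the circles. *)
have [k|u u01|k k'|P [PE P_pw]] := @affine_exchange R n C (fun k => q k)
    (fun k => (n%:R * L k)^-1) C0 Cn C_step nL0.
- rewrite nL -qS; split; first by rewrite divr_ge0 ?ler0n.
  by rewrite -qn; apply: qle; rewrite ltn_ord leqnn.
- have [|l ln lu] := @locate R q n u; first by rewrite qn /q mul0r.
  by exists (Ordinal ln); rewrite nL -qS.
- rewrite !nL -!qS => h1 h2; apply: val_inj.
  by apply: (locate_uniq q_step); rewrite ?ltn_ord.
have P_inc x y : pos x < pos y -> pos (P x) < pos (P y).
  move=> xy; have [|k kn kx] := @locate R C n (pos x); first by rewrite C0 Cn I01P.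
  have [|l ln ly] := @locate R C n (pos y); first by rewrite C0 Cn I01P.
  rewrite (PE (Ordinal kn)) // (PE (Ordinal ln)) //=.
  case: (ltngtP k l) => kl; last first.
  - subst l; rewrite (bool_irrelevance ln kn).
    by rewrite ltrD2l ltr_pM2l // ltrD2r.
  - have := Cle l.+1 k; rewrite kl ltnW // => /(_ isT); lra.
  - have : q k.+1 <= q l by apply: qle; rewrite kl ltnW.
    have : 0 <= (n%:R * L (Ordinal ln))^-1 * (pos y - C l).
      by apply: mulr_ge0; [exact: ltW | lra].
    have : (n%:R * L (Ordinal kn))^-1 * (pos x - C k) < 1 / n%:R.
      by rewrite -(nL (Ordinal kn)) ltr_pM2l // ltrD2r; case/andP: kx.
    by rewrite qS; lra.
exists n, E, P, L; split => //.
- apply: piecewise_impl E_pw => g D [i gD].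
  by exists (C (co i) + off i - 1 * p i) => x Dx; rewrite gD // mul1r.
- have [Pc Pc'] := increasing_homeo P_inc; split=> //.
  by apply: piecewise_impl P_pw => g D [k gD]; exists (n%:R * L k)^-1; eexists; exact: gD.
pose pt := line (P * E)%g L; rewrite -/pt.
have ptE i t : 0 <= t < len i -> pt (co i) (off i + t) = circ (p i + t).
  move=> ti; have [off0 offL] := offP i; have [g0 g1] := p01 i.
  have lenE : len i = p i.+1 - p i by [].
  have px : pos (circ (p i + t)) = p i + t.
    by rewrite circ_id //; lra.
  have pE : pos (E (circ (p i + t))) = C (co i) + (off i + t).
    by rewrite (EE i) ?px; lra.
  have pPE : pos (P (E (circ (p i + t)))) =
      q (co i) + (off i + t) / (n%:R * L (co i)).
    by rewrite (PE (co i)) ?CS ?pE; [rewrite [C _ + _]addrC addrK mulrC | lra].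
  have small : 0 <= (off i + t) / (n%:R * L (co i)) < 1 / n%:R.
    rewrite divr_ge0 ?mulr_ge0 ?ler0n ?(ltW (L0 _)) //=; last lra.
    by rewrite -(nL (co i)) CS [C _ + _]addrC addrK mulrC ltr_pM2l //; lra.
  rewrite /pt /line mod_inv_id //.
  have -> : circ ((co i)%:R / n%:R + (off i + t) / (n%:R * L (co i))) =
      (P * E)%g (circ (p i + t)).
    by rewrite -[RHS]circK -pPE.
  exact: bij_funK.
move=> k u; have [v vL uv] := line_reduce (P * E)%g u (L0 k).
have [i ik iv] := cover k v vL; pose t := v - off i.
have uE d : pt k (u + d) = pt (co i) (off i + (t + d)).
  by rewrite /pt uv -ik; congr line; rewrite /t; ring.
have [g0 g1] := p01 i; have lenE : len i = p i.+1 - p i by [].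
have t_itv : 0 <= t < len i by rewrite /t; lra.
have u0 : pt k u = circ (p i + t) by rewrite -[u]addr0 uE addr0 ptE.
(* Inside a piece [theta] is the identity and short moves stay in the piece. *)
have [t0|t0] := ltP 0 t.
  exists (Num.min t (len i - t)); first by rewrite lt_min t0 subr_gt0; case/andP: t_itv.
  move=> d /andP[d0]; rewrite lt_min => /andP[dt dl]; rewrite u0 !uE !ptE; [|lra|lra].
  rewrite theta_id => [|i']; first by rewrite !rotate_circ !(addrA (p i)).
  rewrite circ_id => [e|]; last lra.
  have : i' = i.
    apply: val_inj; apply: (locate_uniq p_step); rewrite ?ltn_ord //.
      by lra.
    by have := p_step i' (ltn_ord i'); lra.
  by move=> ii; move: e; rewrite ii; lra.
have {}t0 : t = 0 by apply/le_anti; rewrite t0; case/andP: t_itv.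
exists (Num.min (len i) (len (prev i))); first by rewrite lt_min !len0.
move=> d /andP[d0]; rewrite lt_min => /andP[dl dl'].
rewrite !uE t0 add0r ptE ?u0; last by lra.
rewrite t0 addr0 theta_p !rotate_circ; split=> //.
(* Left of the start of piece [i] lies the end of [prev i], after adding one period if [i] has
   offset 0. *)
have -> : pt (co i) (off i + (0 - d)) =
    pt (co (prev i)) (off (prev i) + (len (prev i) - d)).
  rewrite co_prev; have [->|[-> off_last]] := off_prev i.
    by congr (pt _ _); ring.
  rewrite /pt -(lineDz (P * E)%g (0 + (0 - d)) 1) // -off_last.
  by congr (line _ _ _ _); ring.
by rewrite ptE; [congr circ; rewrite /len; ring | lra].
Qed.

End Decomposition.

(** * Flows on a union of circles *)

Section Flow.
Variable R : realType.

(** [T] and its complement are both open, and the real line is connected. *)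
Lemma locally_constant_prop (T : set R) : T 0 ->
  (forall t, exists2 e : R, 0 < e & forall s, `|s| < e -> T t <-> T (t + s)) ->
  forall t, T t.
Proof.
move=> T0 loc t; have openP (A : set R) :
    (forall t, A t -> exists2 e : R, 0 < e & forall s, `|s| < e -> A (t + s)) -> open A.
  move=> H; rewrite openE => u Au; have [e e0 he] := H u Au.
  apply/nbhs_ballP; exists e => //= v; rewrite /ball /= distrC => /he.
  by rewrite addrC subrK.
have openT : open T.
  by apply: openP => u Tu; have [e e0 he] := loc u; exists e => // s /he [+ _]; exact.
have openCT : open (~` T).
  apply: openP => u nTu; have [e e0 he] := loc u.
  by exists e => // s /he [_ h] /h.
have conn : connected [set: R] by apply/connected_intervalP.
suff -> : T = setT by [].
apply: conn; first by exists 0.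
- by exists T => //; rewrite setTI.
- by exists T; [rewrite -[T]setCK; exact: open_closedC | rewrite setTI].
Qed.

Section Action.
Variables (X : Type) (F : R -> X -> X).
Hypothesis F0 : forall x, F 0 x = x.
Hypothesis FD : forall s t x, F s (F t x) = F (t + s) x.

(** For fixed [x], whether commutation holds at time [t] is locally constant in [t], because each
    [F s] is invertible. *)
Lemma flow_commute (g : X -> X) :
  (forall x, exists2 e : R, 0 < e & forall s, `|s| < e -> g (F s x) = F s (g x)) ->
  forall t x, g (F t x) = F t (g x).
Proof.
move=> loc t x; move: t; apply: locally_constant_prop; first by rewrite !F0.
move=> t; have [e e0 he] := loc (F t x); exists e => // s /he.
rewrite FD => ->; split => [->|]; first by rewrite FD.
rewrite -[F (t + s) _]FD => /(congr1 (F (- s))).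
by rewrite !(FD (- s) s) subrr !F0.
Qed.

End Action.

Lemma mod_inv_formula_IET n (g : bijection (I01 R)) (sigma : 'I_n -> R)
    (alpha : 'I_n -> R) : (0 < n)%N ->
  (forall (i : 'I_n) (x : I01 R), i%:R / n%:R <= pos x < i.+1%:R / n%:R ->
     pos (g x) = sigma i + mod_inv n (pos x - i%:R / n%:R + alpha i)) ->
  IET g.
Proof.
move=> n0 gE; have nR : 0 < n%:R :> R by rewrite ltr0n.
have nR0 : n%:R != 0 :> R by rewrite gt_eqF.
pose q l : R := l%:R / n%:R.
have qn : q n = 1 by rewrite /q divff.
(* Over the [i]-th block [n (t - i/n + alpha i)] runs through a half-open interval of length 1, so
   its floor jumps at most once, at the ceiling of [n alpha i]. *)
pose brk (i : 'I_n) := q i + (Num.ceil (n%:R * alpha i))%:~R / n%:R - alpha i.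
apply: (@piecewise_of_breaks _ _ _
  ([seq q l | l <- iota 0 n.+1] ++ [seq brk i | i <- enum 'I_n])).
move=> u v u0 uv v1 noBreak.
have [|l ln lu] := @locate R q n u; first by rewrite qn /q mul0r; lra.
pose i := Ordinal ln; have /andP[lu1 lu2] := lu.
have vl : v <= q l.+1.
  rewrite leNgt; apply/negP => h; have := noBreak (q l.+1).
  rewrite lu2 h mem_cat map_f ?mem_iota /= => [/(_ isT)|]; first by [].
  by rewrite add0n ltnS.
pose w t := n%:R * (t - q i + alpha i).
exists (sigma i - q i + alpha i - (Num.floor (w u))%:~R / n%:R) => x /andP[ux xv].
rewrite -[LHS]/(pos (g x)) (gE i) ?/mod_inv -/(q i); last first.
  by rewrite -/(q _) -/(q _) /=; move: ux xv; rewrite -!/(pos x); lra.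
move: ux xv; rewrite -!/(pos x) -/(w (pos x)) => ux xv.
suff -> : Num.floor (w (pos x)) = Num.floor (w u) by ring.
have wux : w u <= w (pos x) by rewrite /w ler_pM2l //; lra.
(* If the floor increased, the next integer [z] would be reached at some [r] in the piece, and this
   [r] is the break [brk i]. *)
apply/le_anti; rewrite (le_floor wux) andbT leNgt; apply/negP => fl.
pose z := Num.floor (w u) + 1.
have zx : z%:~R <= w (pos x) by rewrite -floor_ge_int /z lezD1.
have uz : w u < z%:~R by rewrite /z floorD1_gt.
pose r := q i + z%:~R / n%:R - alpha i.
have rz : z%:~R = n%:R * (r - q i + alpha i).
  by rewrite /r; field.
have ur : u < r by move: uz; rewrite rz /w ltr_pM2l //; lra.
have rx : r <= pos x by move: zx; rewrite rz /w ler_pM2l //; lra.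
have rE : r = brk i.
  rewrite /r /brk; congr (_ + _%:~R / _ - _); symmetry; apply: ceil_def.
  have qS : q l.+1 = q l + 1 / n%:R by rewrite /q -natr1 mulrDl.
  have one : 1%:~R = n%:R * (1 / n%:R) :> R by rewrite mul1r divff.
  rewrite intrB rz one -mulrBr ltr_pM2l // ler_pM2l //.
  by move: lu1 ur rx xv vl; rewrite qS /=; lra.
have r_brk : r \in [seq brk i | i <- enum 'I_n] by rewrite rE map_f ?mem_enum.
have := noBreak r; rewrite mem_cat r_brk orbT => /(_ isT).
by rewrite ur (le_lt_trans rx xv).
Qed.

End Flow.

(** * The unit speed flow and its centraliser *)

Section LineFlow.
Variables (R : realType) (n : nat) (Phi : bijection (I01 R)) (L : 'I_n -> R).
Hypothesis n_gt0 : (0 < n)%N.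
Hypothesis L_gt0 : forall k, 0 < L k.

Let nR : 0 < n%:R :> R. Proof. by rewrite ltr0n. Qed.

Let q (l : nat) : R := l%:R / n%:R.

Let qS l : q l.+1 = q l + 1 / n%:R.
Proof. by rewrite /q -natr1 mulrDl. Qed.

Let q_step l : (l < n)%N -> q l < q l.+1.
Proof. by rewrite qS ltrDl divr_gt0. Qed.

Let qn : q n = 1.
Proof. by rewrite /q divff ?gt_eqF. Qed.

Let q_itv (k : 'I_n) r : 0 <= r < 1 / n%:R -> 0 <= q k + r < 1.
Proof.
move=> h; have q0 : 0 <= q k by rewrite /q divr_ge0 ?ler0n.
have : q k.+1 <= q n by apply: (subdivision_le q_step); rewrite ltn_ord leqnn.
by rewrite qn qS; lra.
Qed.

Lemma pos_line k u :
  pos (Phi (line Phi L k u)) = k%:R / n%:R + mod_inv n (u / (n%:R * L k)).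
Proof. by rewrite /line bij_invK circ_id // q_itv // mod_inv_itv. Qed.

Lemma line_block (k : 'I_n) x : k%:R / n%:R <= pos (Phi x) < k.+1%:R / n%:R ->
  x = line Phi L k ((pos (Phi x) - k%:R / n%:R) * (n%:R * L k)).
Proof.
move=> h; rewrite /line mulfK ?mulf_neq0 ?gt_eqF // mod_inv_id //.
  by rewrite [_ + (_ - _)]addrC subrK circK bij_funK.
by move: h; rewrite -/(q _) -/(q _) qS; lra.
Qed.

Lemma line_surj x : exists k u, x = line Phi L k u.
Proof.
have [|l ln lx] := @locate R q n (pos (Phi x)).
  by rewrite qn /q mul0r I01P.
by exists (Ordinal ln); eexists; exact: (@line_block (Ordinal ln) x lx).
Qed.

Lemma line_eq k k' u u' : line Phi L k u = line Phi L k' u' ->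
  k = k' /\ exists z : int, u = u' + z%:~R * L k'.
Proof.
move=> e; have := pos_line k u; rewrite e pos_line -!/(q _) => e'.
have kk' : k = k'.
  have := mod_inv_itv (u / (n%:R * L k)) n_gt0.
  have := mod_inv_itv (u' / (n%:R * L k')) n_gt0 => h h'.
  by apply: val_inj; apply: (locate_uniq q_step); rewrite ?ltn_ord // qS; lra.
split=> //; rewrite {}kk' in e' *.
move: e' => /addrI/esym/mod_inv_eq[z uz]; exists z.
have nL : n%:R * L k' != 0 by rewrite mulf_neq0 ?gt_eqF.
rewrite -[u](divfK nL) uz mulrDl divfK //; congr (_ + _).
by rewrite mulrA divfK ?gt_eqF.
Qed.

(** Any choice of parameters works, since they are unique up to the period. *)
Lemma line_flow : exists F : R -> I01 R -> I01 R,
  forall k u t, F t (line Phi L k u) = line Phi L k (u + t).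
Proof.
have /choice[kk kkP] := line_surj; have /choice[uu uuP] := kkP.
exists (fun t x => line Phi L (kk x) (uu x + t)) => k u t.
have := uuP (line Phi L k u); move: (kk _) (uu _) => k' u' /line_eq[-> [z ->]].
by rewrite addrAC lineDz.
Qed.

(** Pigeonhole: the circles are cut into finitely many arcs of length at most [e], and two terms
    share an arc. *)
Lemma flow_recurrence (F : R -> I01 R -> I01 R)
    (F_line : forall k u t, F t (line Phi L k u) = line Phi L k (u + t))
    (x_ : nat -> I01 R) (e : R) : 0 < e ->
  exists i j s, [/\ i != j, 0 <= s < e & x_ j = F s (x_ i)].
Proof.
move=> e0.
have /choice[kk kkP] i : exists k, exists u, 0 <= u < L k /\ x_ i = line Phi L k u.
  have [k [u xE]] := line_surj (x_ i); have [v vL uv] := line_reduce Phi u (L_gt0 k).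
  by exists k, v; split=> //; rewrite xE -[u]addr0 uv addr0.
have /choice[uu uuP] := kkP.
pose K := Num.trunc ((\sum_k L k) / e).
have L_le k : L k <= \sum_k L k.
  by rewrite (bigD1 k) //= lerDl sumr_ge0 // => l _; exact: ltW.
have uK i : (Num.trunc (uu i / e) < K.+1)%N.
  rewrite ltnS; apply: le_truncn; rewrite ler_pM2r ?invr_gt0 //.
  by have [/andP[_ /ltW h] _] := uuP i; exact: le_trans h (L_le _).
pose cell i : 'I_n * 'I_K.+1 := (kk i, Ordinal (uK i)).
have [i [j [ij cij]]] : exists i j, i != j /\ cell i = cell j.
  apply: contrapT => H; apply: infinite_nat.
  rewrite -(preimage_setT cell); apply: finite_preimage finite_finset.
  move=> i j _ _ cij; apply/eqP; apply: contrapT => /negP ij; apply: H.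
  by exists i, j.
case: cij => kij tij.
(* The two terms are ordered along their circle so that the travel time is nonnegative. *)
have step (i' j' : nat) : i' != j' -> kk i' = kk j' -> uu i' <= uu j' ->
    Num.trunc (uu i' / e) = Num.trunc (uu j' / e) ->
    exists i j s, [/\ i != j, 0 <= s < e & x_ j = F s (x_ i)].
  move=> ne kE le tE; exists i', j', (uu j' - uu i'); split=> //.
    rewrite subr_ge0 le /=.
    have [/andP[h1 _] _] := uuP i'; have [/andP[h2 _] _] := uuP j'.
    have /truncn_itv/andP[t1 _] : 0 <= uu i' / e by rewrite divr_ge0 // ltW.
    have /truncn_itv/andP[_ t2] : 0 <= uu j' / e by rewrite divr_ge0 // ltW.
    rewrite -tE -natr1 in t2.
    by rewrite -[e]mul1r -ltr_pdivrMr // mulrBl; lra.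
  by have [_ ->] := uuP i'; have [_ ->] := uuP j'; rewrite F_line kE addrC subrK.
have [le|/ltW le] := leP (uu i) (uu j); first exact: (step i j).
by apply: (step j i); rewrite // eq_sym.
Qed.

(** A map commuting with the flow carries each circle to a circle by a rotation, determined by the
    image of one base point. *)
Lemma Gn_of_flow_commute (F : R -> I01 R -> I01 R)
    (F_line : forall k u t, F t (line Phi L k u) = line Phi L k (u + t))
    (g : bijection (I01 R)) :
  (forall t x, g (F t x) = F t (g x)) -> Gn n (Phi * g * Phi^-1)%g.
Proof.
move=> gF; pose c i := line Phi L i 0.
have /fin_all_exists[sg sgP] i : exists k, exists b, g (c i) = line Phi L k b.
  by have [k [u h]] := line_surj (g (c i)); exists k, u.
have /fin_all_exists[b bP] := sgP.
have gl i t : g (line Phi L i t) = line Phi L (sg i) (b i + t).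
  by have := gF t (c i); rewrite bP !F_line add0r.
have g_inj : injective g := can_inj (@bij_funK _ g).
have sg_inj : injective sg.
  move=> i i' e; have := gl i (b i' - b i); rewrite [b i + _]addrC subrK e.
  by rewrite -[b i']addr0 -gl => /g_inj/line_eq[].
(* [L i] is a period of the image circle and conversely, so each length is a positive multiple of
   the other. *)
have L_le i : L (sg i) <= L i /\ L i <= L (sg i).
  have pos_mul (r s : R) (z : int) : 0 < r -> 0 < s -> r = z%:~R * s -> s <= r.
    move=> r0 s0 rE; rewrite rE ler_peMl ?(ltW s0) // ler1z.
    by rewrite -gtz0_ge1 -(ltr0z R); move: r0; rewrite rE pmulr_lgt0.
  have per k : line Phi L k (L k) = line Phi L k 0.
    by rewrite -(@lineDz _ _ Phi L k 0 1) // mul1r add0r.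
  split.
    have := gl i (L i); rewrite per gl addr0.
    move=> /line_eq[_ [z h]]; apply: (pos_mul _ _ (- z)) => //.
    by rewrite intrN mulNr; lra.
  have := lineDz Phi (b i) 1 (L_gt0 (sg i)); rewrite mul1r -gl.
  rewrite -[b i]addr0 -gl => /g_inj/line_eq[_ [z]]; rewrite add0r.
  exact: pos_mul.
have L_eq i : L (sg i) = L i.
  by apply: le_anti; case: (L_le i) => -> ->.
have formula (i : 'I_n) (x : I01 R) : i%:R / n%:R <= pos x < i.+1%:R / n%:R ->
    pos ((Phi * g * Phi^-1)%g x) = (sg i)%:R / n%:R +
      mod_inv n (pos x - i%:R / n%:R + b i / (n%:R * L i)).
  move=> ix; have xE : Phi (bij_inv Phi x) = x by rewrite bij_invK.
  have := @line_block i (bij_inv Phi x); rewrite xE => /(_ ix) e.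
  rewrite -[LHS]/(pos (Phi (g (bij_inv Phi x)))) e gl pos_line L_eq; congr (_ + mod_inv n _).
  by rewrite mulrDl mulfK ?mulf_neq0 ?gt_eqF // addrC.
split; first exact: mod_inv_formula_IET n_gt0 formula.
exists (perm sg_inj), (fun i => b i / (n%:R * L i)) => i x ix.
by rewrite permE; exact: formula.
Qed.

End LineFlow.

(** * Free actions *)

Section FreeAction.
Variables (R : realType) (G : groupType).
Variable rho : {multiplicative G -> bijection (I01 R)}.
Hypothesis G_tf : torsion_free G.
Hypothesis rho_IET : forall x : G, IET (rho x).
Hypothesis rho_free : free_action rho.

Lemma actionM g h x : rho (g * h)%g x = rho g (rho h x).
Proof. by rewrite gmulfM. Qed.

Lemma action1 x : rho 1%g x = x.
Proof.
suff -> : rho 1%g = 1%g by [].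
by apply: (mulgI (rho 1%g)); rewrite mulg1 -gmulfM mulg1.
Qed.

Lemma action_free : free_action rho -> forall g x, rho g x = x -> g = 1%g.
Proof. by move=> fr g x gx; apply: fr; exists x. Qed.

(** The action laws for [l] follow from composition and uniqueness of left germs. *)
Lemma left_action : exists l : G -> I01 R -> I01 R,
  [/\ forall g x, left_germ (rho g) x (l g x), forall x, l 1%g x = x,
      forall g h x, l (g * h)%g x = l g (l h x) &
      forall g, finite_set [set x | rho g x <> l g x]].
Proof.
have /choice[l lP] g : exists F : I01 R -> I01 R,
    (forall x, left_germ (rho g) x (F x)) /\ finite_set [set x | rho g x <> F x].
  have [D Dfin DP] := IET_left_germ (rho_IET g).
  have /choice[F FP] x : exists y, left_germ (rho g) x y /\ (~ D x -> y = rho g x).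
    by have [y h1 h2] := DP x; exists y.
  exists F; split=> [x|]; first by have [] := FP x.
  apply: sub_finite_set Dfin => x /= ne; apply: contrapT => /(FP x).2 e.
  exact: ne.
have lG g x := (lP g).1 x.
exists l; split=> [//|x|g h x|g]; last exact: (lP g).2.
- apply: left_germ_uniq (lG 1%g x) _; have [e e0 he] := left_germ_id x.
  by exists e => // t te; rewrite action1.
- apply: left_germ_uniq (lG _ x) _.
  have [e e0 he] := left_germ_comp (lG h x) (lG g (l h x)).
  by exists e => // t te; rewrite actionM; exact: he.
Qed.

(** Forwards, the flow is a rotation and the right germ of [rho g] suffices. Backwards it starts
    from [theta x], where the left germ [l g] applies and [theta] is carried across by the
    intertwining. *)
Lemma intertwines_flow (l : G -> I01 R -> I01 R) (theta : I01 R -> I01 R)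
    (F : R -> I01 R -> I01 R) (g : G) :
  (forall g x, left_germ (rho g) x (l g x)) ->
  (forall x, F 0 x = x) -> (forall s t x, F s (F t x) = F (t + s) x) ->
  (forall x, exists2 e : R, 0 < e & forall d, 0 < d < e ->
     F d x = rotate d x /\ F (- d) x = rotate (- d) (theta x)) ->
  intertwines (fun g => rho g) l theta g ->
  forall t x, rho g (F t x) = F t (rho g x).
Proof.
move=> lP F0 FD F_germ tg; apply: flow_commute => // x.
have [e1 e10 h1] := F_germ x; have [e2 e20 h2] := F_germ (rho g x).
have [e3 e30 h3] := IET_right_germ x (rho_IET g).
have [e4 e40 h4] := lP g (theta x).
exists (Num.min (Num.min e1 e2) (Num.min e3 e4)).
  by rewrite !lt_min e10 e20 e30.
move=> s; rewrite !lt_min => /andP[/andP[s1 s2] /andP[s3 s4]].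
have [s0|s0|->] := ltgtP s 0; last by rewrite !F0.
  rewrite ltr0_norm // in s1 s2 s3 s4.
  have n0 : 0 < - s by rewrite oppr_gt0.
  have [|_] := h1 (- s); first by rewrite n0.
  have [|_] := h2 (- s); first by rewrite n0.
  rewrite opprK => -> ->; by rewrite tg -[s]opprK h4 // n0.
rewrite gtr0_norm // in s1 s2 s3 s4.
have [|-> _] := h1 s; first by rewrite s0.
have [|-> _] := h2 s; first by rewrite s0.
by rewrite h3 // ltW.
Qed.

(* If [h] and [k] move [y] and [g^-1 y] by small positive amounts along the
   flow, then [h] and [g k g^-1] both act near [y] as small translations; hence
   their commutator fixes [y], and it is trivial by freeness. *)
Lemma intertwines_all (l : G -> I01 R -> I01 R) (theta : I01 R -> I01 R)
    (F : R -> I01 R -> I01 R) (a : G) :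
  (forall g x, left_germ (rho g) x (l g x)) ->
  (forall x, l 1%g x = x) ->
  (forall g h x, l (g * h)%g x = l g (l h x)) ->
  (forall g, finite_set [set x | rho g x <> l g x]) ->
  finite_set [set x | theta x <> x] ->
  a <> 1%g -> intertwines (fun g => rho g) l theta a ->
  (forall x, F 0 x = x) -> (forall s t x, F s (F t x) = F (t + s) x) ->
  (forall x, exists2 e : R, 0 < e & forall d, 0 < d < e ->
     F d x = rotate d x /\ F (- d) x = rotate (- d) (theta x)) ->
  (forall (x_ : nat -> I01 R) (e : R), 0 < e ->
     exists i j s, [/\ i != j, 0 <= s < e & x_ j = F s (x_ i)]) ->
  forall g, intertwines (fun g => rho g) l theta g.
Proof.
move=> lP l1 lM l_fin theta_fin a1 ta F0 FD F_germ F_rec g.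
have comm_F h := intertwines_flow lP F0 FD F_germ (g := h).
have a_inj := expg_inj_of_torsion_free G_tf a1.
(* Recurrence along the orbit of [x] under the powers of [a]; as these commute with the flow,
   [a^-i a^j] moves [x] by the same small time [s]. *)
have small x (e : R) : 0 < e -> exists (h : G) s,
    [/\ h <> 1%g, intertwines (fun g => rho g) l theta h, 0 <= s < e &
        rho h x = F s x].
  move=> /(F_rec (fun n => rho (a ^+ n)%g x))[i [j [s [ij se xij]]]].
  have tX n : intertwines (fun g => rho g) l theta (a ^+ n)%g.
    exact: (intertwinesX action1 l1 actionM lM).
  have tV : intertwines (fun g => rho g) l theta (a ^+ i)^-1%g.
    exact: (intertwinesV action1 l1 actionM lM).
  exists ((a ^+ i)^-1 * a ^+ j)%g, s; split=> //.
  - move=> e1; case/eqP: ij; apply: a_inj => /=.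
    by apply: (mulgI (a ^+ i)^-1%g); rewrite e1 mulVg.
  - exact: (intertwinesM actionM lM).
  by rewrite actionM xij comm_F // -actionM mulVg action1.
pose y : I01 R := circ 0; pose x := rho g^-1%g y.
have gx : rho g x = y by rewrite -actionM mulgV action1.
(* Only forward times are used: [theta] plays no part there, and [g] is not yet known to
   intertwine. *)
have [e e0 gF] : exists2 e : R, 0 < e &
    forall s, 0 <= s < e -> rho g (F s x) = F s y.
  have [e1 e10 h1] := F_germ x; have [e2 e20 h2] := F_germ y.
  have [e3 e30 h3] := IET_right_germ x (rho_IET g).
  exists (Num.min (Num.min e1 e2) e3); first by rewrite !lt_min e10 e20 e30.
  move=> s; rewrite !lt_min le_eqVlt => /andP[/orP[/eqP<- _|s0]].
    by rewrite !F0.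
  move=> /andP[/andP[s1 s2] s3].
  have [|-> _] := h1 s; first by rewrite s0.
  have [|-> _] := h2 s; first by rewrite s0.
  by rewrite h3 ?gx // ltW.
(* Halving keeps the sum of two displacements below [e]. *)
have e20 : 0 < e / 2 by rewrite divr_gt0.
have [h [s [h1 th /andP[s0 se] hy]]] := small y _ e20.
have [k [s' [k1 tk /andP[s'0 s'e] kx]]] := small x _ e20.
pose h' := (g * k * g^-1)%g.
have gVF t : 0 <= t < e -> rho g^-1%g (F t y) = F t x.
  by move=> te; rewrite -gF // -actionM mulVg action1.
(* Both products send [y] to [F (s + s') y]. *)
have comm : (h' * h = h * h')%g.
  apply: (free_inj action1 actionM (action_free rho_free) (x := y)).
  rewrite !actionM hy gVF; last lra.
  rewrite (_ : rho g^-1%g y = x) // kx (comm_F k) // kx FD !gF; [|lra|lra].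
  by rewrite (comm_F h) // hy FD addrC.
have th' : intertwines (fun g => rho g) l theta h'.
  apply: (intertwines_of_conj action1 l1 actionM lM
  (action_free rho_free) l_fin G_tf theta_fin th h1).
  by rewrite comm -mulgA mulgV mulg1.
exact: (intertwines_of_conj action1 l1 actionM lM
  (action_free rho_free) l_fin G_tf theta_fin tk k1 th').
Qed.

End FreeAction.

Theorem theorem8 (R : realType) (G : groupType)
    (G_fg : finitely_generated G) (G_tf : torsion_free G)
    (G_Z2 : contains_Z2 G)
    (rho : {multiplicative G -> bijection (I01 R)})
    (rho_IET : forall x : G, IET (rho x))
    (rho_free : free_action rho)
    (rho_faithful : injective rho) :
  exists (n : nat) (E P : bijection (I01 R)),
    [/\ (0 < n)%N, IET E, PL_homeo P &
        forall x : G, Gn n ((P * E) * rho x * (P * E)^-1)%g].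
Proof.
have [l [lP l1 lM l_fin]] := left_action rho_IET.
have [f [f_inj fD]] := G_Z2.
have [theta [theta_inj theta_fin theta_a]] :=
  ex_intertwiner (@action1 R G rho) l1 (@actionM R G rho) lM
    (action_free rho_free) l_fin f_inj fD.
have [n [E [P [L [n0 E_IET P_PL L0 germ]]]]] :=
  circle_decomposition theta_inj theta_fin.
have [F F_line] := line_flow (P * E)%g n0 L0.
exists n, E, P; split=> // g.
apply: (Gn_of_flow_commute n0 L0 F_line).
have surj x := line_surj (P * E)%g n0 L0 x.
have F0 x : F 0 x = x by have [k [u ->]] := surj x; rewrite F_line addr0.
have FD s t x : F s (F t x) = F (t + s) x.
  by have [k [u ->]] := surj x; rewrite !F_line addrA.
have F_germ x : exists2 e : R, 0 < e & forall d, 0 < d < e ->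
    F d x = rotate d x /\ F (- d) x = rotate (- d) (theta x).
  have [k [u ->]] := surj x; have [e e0 he] := germ k u.
  by exists e => // d /he; rewrite !F_line.
have a1 : f (1, 0) <> 1%g.
  move=> e; have f0 : f 0 = 1%g by apply: (mulgI (f 0)); rewrite mulg1 -fD addr0.
  by have /f_inj[] := etrans e (esym f0).
apply: (intertwines_flow rho_IET lP F0 FD F_germ).
apply: (intertwines_all G_tf rho_IET rho_free lP l1 lM l_fin theta_fin a1
  theta_a F0 FD F_germ).
exact: (flow_recurrence n0 L0 F_line).
Qed.
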